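(* Let $E$ be a real Banach space which is uniformly convex with modulus $\delta_E$, and let $d>0$. Let $A\subset E$ be a nonempty closed set which is weakly convex with modulus of nonconvexity $\gamma_A(\varepsilon)$, $\varepsilon\in[0,2d)$, with $d\,\delta_E(\varepsilon/d)>\gamma_A(\varepsilon)$ for all $\varepsilon\in(0,2d)$, and suppose condition (i) holds for $\delta(t)=d\,\delta_E(t/d)$ and $\gamma=\gamma_A$. Suppose further that $A\subset B_r(a)$ for some $a\in E$ and $r>0$ with $2r<d$, and that $\gamma_A(\varepsilon)<d\,\delta_E(\varepsilon/d)$ for all $\varepsilon\in(0,\operatorname{diam}A)$. Then $A$ is a continuous retract of $E$, i.e. there is a continuous map $\phi:E\to A$ with $\phi(x)=x$ for all $x\in A$.
   Context: $B_r(a)$ is the closed ball. $\delta_E(\varepsilon)=\sup\{\delta\ge0: B_\delta(\frac{x_1+x_2}{2})\subset B_1(0)\ \forall x_1,x_2\in B_1(0),\ \|x_1-x_2\|=\varepsilon\}$ on $[0,2)$; $E$ uniformly convex means $\delta_E>0$ on $(0,2)$. For closed $A$ and $\varepsilon>0$, $\gamma^0_A(\varepsilon)=\inf\{\gamma>0: B_\gamma(\frac{x_1+x_2}{2})\cap A\ne\emptyset\ \forall x_1,x_2\in A,\ \|x_1-x_2\|\le\varepsilon\}$; modulus of nonconvexity $\gamma_A(0)=0$, $\gamma_A(\varepsilon)=\lim_{\tau\downarrow\varepsilon}\gamma^0_A(\tau)$. $A$ is weakly convex with modulus $\gamma_A$ on $[0,d')$ if $\gamma_A(\varepsilon)<\varepsilon/2$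 for $\varepsilon\in(0,d')$. Condition (i) for moduli $\delta,\gamma$: there is $s_0>0$ such that for every $s\in(0,s_0]$: (1) there is $t_s>s$ with $\delta(t_s-s)=\gamma(t_s)$; (2) $t\mapsto\delta(t-s)-\gamma(t)$ is positive and increasing for $t>t_s$; (3) there is $t(s)>t_s$ with $\delta(t(s)-s)-\gamma(t(s))=s/2$. *)

(* Defs.v *)
From HB Require Import structures.
From mathcomp Require Import all_boot all_order all_algebra.
From mathcomp Require Import all_classical all_reals all_analysis.
Set Implicit Arguments. Unset Strict Implicit. Unset Printing Implicit Defensive.
Import Order.TTheory GRing.Theory Num.Theory.
Import numFieldNormedType.Exports.
Local Open Scope classical_set_scope.
Local Open Scope ring_scope.

Section Defs.
Context {R : realType} {E : normedModType R}.

Definition cball (a : E) (r : R) : set E := [set y | `|y - a| <= r].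

(* modulus of convexity delta_E on [0,2) (given by the same formula everywhere) *)
Definition modconv (eps : R) : R :=
  sup [set del : R | 0 <= del /\
        forall x1 x2 : E, cball 0 1 x1 -> cball 0 1 x2 -> `|x1 - x2| = eps ->
          cball (2%:R^-1 *: (x1 + x2)) del `<=` cball 0 1].

Definition uniformly_convex : Prop :=
  forall eps : R, 0 < eps < 2%:R -> 0 < modconv eps.

Definition gamma0 (A : set E) (eps : R) : R :=
  inf [set g : R | 0 < g /\
        forall x1 x2 : E, A x1 -> A x2 -> `|x1 - x2| <= eps ->
          cball (2%:R^-1 *: (x1 + x2)) g `&` A !=set0].

Definition modnonconv (A : set E) (eps : R) : R :=
  if eps == 0 then 0 else lim (gamma0 A @ eps^'+).

Definition weakly_convex (A : set E) (d' : R) : Prop :=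
  forall eps : R, 0 < eps < d' -> modnonconv A eps < eps / 2%:R.

Definition diam (A : set E) : R := sup [set `|x - y| | x in A & y in A].

End Defs.

(* condition (i) for moduli delta, gamma defined on [0, D) *)
Definition condition_i {R : realType} (delta gamma : R -> R) (D : R) : Prop :=
  exists2 s0 : R, 0 < s0 & forall s : R, 0 < s <= s0 ->
    exists ts : R, [/\ s < ts,
      delta (ts - s) = gamma ts,
      (forall t t' : R, ts < t -> t < t' -> t' < D ->
          delta (t - s) - gamma t < delta (t' - s) - gamma t'),
      (forall t : R, ts < t -> t < D -> 0 < delta (t - s) - gamma t) &
      exists ts' : R, [/\ ts < ts', ts' < D &
          delta (ts' - s) - gamma ts' = s / 2%:R]].

(* Main.v *)
Require Import Defs.
From HB Require Import structures.
From mathcomp Require Import all_boot all_order all_algebra.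
From mathcomp Require Import all_classical all_reals all_analysis.
From mathcomp Require Import lra.
Set Implicit Arguments. Unset Strict Implicit. Unset Printing Implicit Defensive.
Import Order.TTheory GRing.Theory Num.Theory.
Import numFieldNormedType.Exports.
Local Open Scope classical_set_scope.
Local Open Scope ring_scope.

(** The retraction is the radial retraction onto [cball a r] followed by the
metric projection onto [A]; every point of that ball is within [2 * r < d] of
[A]. If [x1], [x2] in [A] nearly realise the distance [D < d] from [x] to [A]
and [`|x1 - x2|] is close to [e], then the midpoint of [x1] and [x2] lies within
about [D - d * modconv (e / d)] of [x], while a point of [A] lies within about
[modnonconv A e] of the midpoint; as [modnonconv A e < d * modconv (e / d)],
this point is closer to [x] than [D], a contradiction. Compactness of the range
of [e] makes this uniform: points of [A] nearly realising the distance to [x]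
are close to each other. Hence the projection exists, is unique and depends
continuously on [x]. *)

Local Notation midpoint x y := (2%:R^-1 *: (x + y)).

Section NormedModule.
Context {R : realType} {E : normedModType R}.
Implicit Types (c u v x y z : E) (d e r s rho : R).

Lemma midpointxx x : midpoint x x = x.
Proof. by rewrite -mulr2n -(scaler_nat 2 x) scalerA mulVf ?pnatr_eq0// scale1r. Qed.

Lemma midpointB x y c : midpoint x y - c = midpoint (x - c) (y - c).
Proof. by rewrite -{1}(midpointxx c) -scalerBr opprD addrACA. Qed.

Lemma scaler_midpoint d x y : d *: midpoint x y = midpoint (d *: x) (d *: y).
Proof. by rewrite -scalerDr !scalerA mulrC. Qed.

Lemma dist_midpointl x y z : `|midpoint x y - midpoint x z| = `|y - z| / 2.
Proof. by rewrite -scalerBr opprD addrACA subrr add0r normrZ gtr0_norm ?invr_gt0// mulrC. Qed.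

Lemma exists_aligned_unit_vector v x : v != 0 ->
  exists2 u, `|u| = 1 & forall e, 0 <= e -> `|x + e *: u| = `|x| + e.
Proof.
move=> v0; have [->|x0] := eqVneq x 0.
  exists (`|v|^-1 *: v) => [|e e0]; first exact: normfZV.
  by rewrite add0r normr0 add0r normrZ normfZV// mulr1 ger0_norm.
exists (`|x|^-1 *: x) => [|e e0]; first exact: normfZV.
rewrite -{1}[x](scalerKV (a := `|x|)) ?normr_eq0// -scalerDl normrZ normfZV// mulr1.
by rewrite ger0_norm// addr_ge0.
Qed.

Lemma exists_at_dist_on_line x y e : x != y -> 0 <= e ->
  exists2 z, `|x - z| = e & `|z - y| = `|e - `|x - y| |.
Proof.
rewrite -subr_eq0 => xy0 e0; pose u := `|x - y|^-1 *: (x - y).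
have u1 : `|u| = 1 by exact: normfZV.
exists (x - e *: u); first by rewrite opprB addrC subrK normrZ u1 mulr1 ger0_norm.
have -> : x - e *: u - y = (`|x - y| - e) *: u.
  by rewrite scalerBl scalerKV ?normr_eq0// addrAC.
by rewrite normrZ u1 mulr1 distrC.
Qed.

Lemma le_dist_center_cball v x c r s : v != 0 -> 0 <= r ->
  cball x r `<=` cball c s -> `|x - c| + r <= s.
Proof.
move=> v0 r0 sub; have [u u1 norm_u] := exists_aligned_unit_vector (x - c) v0.
rewrite -norm_u// addrAC; apply: (sub (x + r *: u)).
by rewrite /cball/= addrAC subrr add0r normrZ u1 mulr1 ger0_norm.
Qed.

Lemma cball_dist_le c r x y : cball c r x -> cball c r y -> `|x - y| <= 2%:R * r.
Proof.
by rewrite /cball/= => xc yc; have := ler_distD c x y; rewrite (distrC c y); lra.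
Qed.

End NormedModule.

Definition modconv_ball {R : realType} (E : normedModType R) (d e : R) : R :=
  d * modconv (E := E) (e / d).

Section ModulusOfConvexity.
Context {R : realType} {E : normedModType R}.
Implicit Types (c x y : E) (d e rho : R).

Lemma norm_midpoint_le_modconv x y : `|x| <= 1 -> `|y| <= 1 -> x != y ->
  `|midpoint x y| <= 1 - modconv (E := E) `|x - y|.
Proof.
move=> x1 y1 xy.
have midpoint_cball (x' y' : E) : `|x'| <= 1 -> `|y'| <= 1 -> `|midpoint x' y'| <= 1.
  by move=> ? ?; rewrite normrZ gtr0_norm ?invr_gt0//; have := ler_normD x' y'; lra.
rewrite lerBrDr addrC -lerBrDr; apply: ge_sup.
  exists 0; split => // x' y'; rewrite /cball/= !subr0 => ? ? _ z /=.
  by rewrite normr_le0 subr_eq0 => /eqP ->; rewrite subr0; exact: midpoint_cball.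
move=> del [del0 /(_ x y)]; rewrite {1 2}/cball/= !subr0 => /(_ x1 y1 erefl) sub.
have xy0 : x - y != 0 by rewrite subr_eq0.
have := le_dist_center_cball xy0 del0 sub; rewrite subr0; lra.
Qed.

Lemma dist_midpoint_le_modconv_ball d c x y : 0 < d ->
  `|x - c| <= d -> `|y - c| <= d -> x != y ->
  `|midpoint x y - c| <= d - modconv_ball E d `|x - y|.
Proof.
move=> d0 xc yc xy.
have dV : `|d^-1| = d^-1 by rewrite gtr0_norm// invr_gt0.
have scaled_dist (u v : E) : `|d^-1 *: (u - v)| = `|u - v| / d by rewrite normrZ dV mulrC.
have in_ball (z : E) : `|z - c| <= d -> `|d^-1 *: (z - c)| <= 1.
  by move=> zc; rewrite scaled_dist ler_pdivrMr// mul1r.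
have diff : d^-1 *: (x - c) - d^-1 *: (y - c) = d^-1 *: (x - y).
  by rewrite -scalerBr opprB addrA subrK.
have := norm_midpoint_le_modconv (in_ball x xc) (in_ball y yc).
rewrite -subr_eq0 diff scaler_eq0 invr_eq0 subr_eq0 gt_eqF// => /(_ xy).
rewrite -scaler_midpoint -midpointB !scaled_dist ler_pdivrMr// mulrBl mul1r.
by rewrite mulrC.
Qed.

(* The ball of radius [rho] is contained in the ball of radius [d] translated
   by [d - rho] away from the midpoint. *)
Lemma dist_midpoint_le_modconv_larger_ball d rho c x y : 0 < d -> rho <= d ->
  `|x - c| <= rho -> `|y - c| <= rho -> x != y ->
  `|midpoint x y - c| <= rho - modconv_ball E d `|x - y|.
Proof.
move=> d0 rho_d xc yc xy; have xy0 : x - y != 0 by rewrite subr_eq0.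
have [u u1 norm_u] := exists_aligned_unit_vector (midpoint x y - c) xy0.
have drho0 : 0 <= d - rho by rewrite subr_ge0.
have in_ball z : `|z - c| <= rho -> `|z - (c - (d - rho) *: u)| <= d.
  move=> zc; rewrite opprB addrCA addrC (le_trans (ler_normD _ _))//.
  by rewrite [X in _ + X]normrZ u1 mulr1 ger0_norm//; lra.
have := dist_midpoint_le_modconv_ball d0 (in_ball x xc) (in_ball y yc) xy.
rewrite opprB addrCA addrC norm_u//; lra.
Qed.

(* No continuity of the modulus is available, so [y] is moved along the line
   through [x] to distance exactly [e] from [x]. *)
Lemma dist_midpoint_le_modconv_perturbed d rho e c x y :
  let b := `|e - `|x - y| | in
  0 < d -> 0 < e -> rho + b <= d ->
  `|x - c| <= rho -> `|y - c| <= rho -> x != y ->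
  `|midpoint x y - c| <= rho + 3 / 2 * b - modconv_ball E d e.
Proof.
move=> b d0 e0 rho_d xc yc xy.
have b0 : 0 <= b by exact: normr_ge0.
have [z xz zy] := exists_at_dist_on_line xy (ltW e0).
have zc : `|z - c| <= rho + b by have := ler_distD y z c; rewrite zy -/b; lra.
have xc' : `|x - c| <= rho + b by lra.
have xz0 : x != z by rewrite -subr_eq0 -normr_gt0 xz.
have := dist_midpoint_le_modconv_larger_ball d0 rho_d xc' zc xz0; rewrite xz.
have := ler_distD (midpoint x z) (midpoint x y) c.
by rewrite dist_midpointl (distrC y z) zy -/b; lra.
Qed.

End ModulusOfConvexity.

Definition midpoints_within {R : realType} {E : normedModType R}
    (A : set E) (e g : R) : Prop :=
  forall x1 x2 : E, A x1 -> A x2 -> `|x1 - x2| <= e ->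
    cball (midpoint x1 x2) g `&` A !=set0.

Section ModulusOfNonconvexity.
Context {R : realType} {E : normedModType R}.
Variable A : set E.
Implicit Types (e g : R).

Let admissible e := [set g : R | 0 < g /\ midpoints_within A e g].

Lemma midpoints_within_self e : midpoints_within A e e.
Proof.
move=> x y Ax Ay xy; exists x; split => //=; rewrite /cball/= -{1}(midpointxx x).
by rewrite dist_midpointl; have := normr_ge0 (x - y); lra.
Qed.

Lemma has_inf_gamma0 e : 0 < e -> has_inf (admissible e).
Proof.
move=> e0; split; last by exists 0 => g [/ltW].
by exists e; split => //; exact: midpoints_within_self.
Qed.

Lemma gamma0_ge0 e : 0 < e -> 0 <= gamma0 A e.
Proof.
by move=> /has_inf_gamma0[ne _]; apply: lb_le_inf => // g [/ltW].
Qed.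

Lemma gamma0_le e e' : 0 < e -> e <= e' -> gamma0 A e <= gamma0 A e'.
Proof.
move=> e0 ee'; have [ne _] := has_inf_gamma0 (lt_le_trans e0 ee').
apply: lb_le_inf => // g [g0 within_g]; apply: ge_inf.
  by case: (has_inf_gamma0 e0).
by split => // x y Ax Ay xy; apply: within_g => //; exact: le_trans xy ee'.
Qed.

Lemma modnonconv_inf e : 0 < e -> modnonconv A e = inf (gamma0 A @` `]e, +oo[).
Proof.
move=> e0; rewrite /modnonconv gt_eqF//; apply: cvg_lim => //.
apply: nondecreasing_at_right_cvgr => //.
- move=> s t; rewrite !in_itv/= !andbT => es _; apply: gamma0_le.
  exact: lt_trans es.
- exists 0 => _ [t + <-]; rewrite /= in_itv/= andbT => et.
  by apply: gamma0_ge0; exact: lt_trans et.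
Qed.

Lemma modnonconv_lt e g : 0 < e -> modnonconv A e < g ->
  exists2 e', e < e' & exists2 g', g' < g & midpoints_within A e' g'.
Proof.
move=> e0; rewrite modnonconv_inf// => /inf_lt [].
  by exists (gamma0 A (e + 1)), (e + 1) => //=; rewrite in_itv/= andbT ltrDl.
move=> _ [e' + <-]; rewrite /= in_itv/= andbT => ee' /inf_lt [].
  by case: (has_inf_gamma0 (lt_trans e0 ee')).
by move=> g' [_ within_g'] g'g; exists e' => //; exists g'.
Qed.

End ModulusOfNonconvexity.

Section DistanceToSet.
Context {R : realType} {E : normedModType R}.
Variable A : set E.
Implicit Types (x y p : E) (X : set E) (eta : R).

Definition dist_to x : R := inf [set `|y - x| | y in A].

Definition near_projections x eta : set E := A `&` cball x (dist_to x + eta).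

Definition is_projection x p : Prop := A p /\ `|p - x| = dist_to x.

(* Tykhonov well-posedness of the best approximation problem, uniform in the
   approximated point [x]. *)
Definition uniformly_well_posed X : Prop := forall e : R, 0 < e ->
  exists2 eta, 0 < eta & forall x x1 x2, X x ->
    near_projections x eta x1 -> near_projections x eta x2 -> `|x1 - x2| < e.

Lemma dist_to_le x y : A y -> dist_to x <= `|y - x|.
Proof. by move=> Ay; apply: ge_inf; [exists 0 => _ [z _ <-] | exists y]. Qed.

Lemma dist_to_adherent x eta : A !=set0 -> 0 < eta ->
  exists2 y, A y & `|y - x| < dist_to x + eta.
Proof.
move=> [y Ay] eta0; have [|_ [z Az <-] zx] := @inf_adherent _ [set `|y - x| | y in A] _ eta0.
  by split; [exists `|y - x|, y | exists 0 => _ [z _ <-]].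
by exists z.
Qed.

Lemma dist_to_lip x y : A !=set0 -> dist_to x <= dist_to y + `|x - y|.
Proof.
move=> A0; apply/ler_addgt0Pr => eta eta0.
have [z Az zy] := dist_to_adherent y A0 eta0.
have := dist_to_le x Az; have := ler_distD y z x; rewrite (distrC y x); lra.
Qed.

Lemma is_projection_id x p : A x -> is_projection x p -> p = x.
Proof.
move=> Ax [_ px]; apply/eqP; rewrite -subr_eq0 -normr_le0 px.
by rewrite (le_trans (dist_to_le x Ax))// subrr normr0.
Qed.

Lemma is_projection_near_projections x y p eta : A !=set0 ->
  is_projection y p -> 2 * `|x - y| <= eta -> near_projections x eta p.
Proof.
move=> A0 [Ap py] xy; split => //; rewrite /cball/=.
have := ler_distD y p x; have := dist_to_lip y x A0; rewrite py (distrC y x); lra.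
Qed.

Lemma uniformly_well_posedW X Y : Y `<=` X ->
  uniformly_well_posed X -> uniformly_well_posed Y.
Proof.
move=> YX wp e /wp[eta eta0 close]; exists eta => // x x1 x2 /YX; exact: close.
Qed.

Lemma dist_to_le_midpoint e g x x1 x2 : midpoints_within A e g ->
  A x1 -> A x2 -> `|x1 - x2| <= e -> dist_to x <= g + `|midpoint x1 x2 - x|.
Proof.
move=> within_g Ax1 Ax2 x12; have [z [zm Az]] := within_g _ _ Ax1 Ax2 x12.
apply: (le_trans (dist_to_le x Az)); apply: (le_trans (ler_distD (midpoint x1 x2) _ _)).
by rewrite lerD2r.
Qed.

End DistanceToSet.

Section WellPosedness.
Context {R : realType} {E : normedModType R}.
Variables (A : set E) (d rho : R).
Hypotheses (d0 : 0 < d) (rho_d : rho < d).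

Lemma near_projections_dist_neq (e : R) : 0 < e -> modnonconv A e < modconv_ball E d e ->
  \forall e' \near e & eta \near 0^'+, forall x x1 x2, dist_to A x <= rho ->
    near_projections A x eta x1 -> near_projections A x eta x2 -> `|x1 - x2| <> e'.
Proof.
move=> e0 /(modnonconv_lt e0)[tau etau [g gD within_g]].
near (0 : R)^'+ => k.
have k0 : 0 < k by [].
have k_gap : k < (modconv_ball E d e - g) / 3 by near: k; apply: nbhs_right_lt; lra.
have k_rho : k < (d - rho) / 2 by near: k; apply: nbhs_right_lt; rewrite divr_gt0 ?subr_gt0.
have k_tau : k < tau - e by near: k; apply: nbhs_right_lt; lra.
have k_e : k < e by near: k; exact: nbhs_right_lt.
exists (ball e k, [set eta | 0 < eta < k]).
  split => /=; first exact: nbhsx_ballx.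
  by near=> eta; apply/andP; split; near: eta; [exact: nbhs_right_gt|exact: nbhs_right_lt].
move=> [e' eta] [/= bk /andP[eta0 etak]] x x1 x2 x_rho [Ax1 x1x] [Ax2 x2x] x12.
have {}bk : `|e - e'| < k by exact: bk.
have x12_tau : `|x1 - x2| <= tau.
  by rewrite x12; have := ler_norm (e' - e); rewrite distrC; lra.
have x12_neq : x1 != x2.
  by rewrite -subr_eq0 -normr_gt0 x12; have := ler_norm (e - e'); lra.
have := dist_to_le_midpoint x within_g Ax1 Ax2 x12_tau.
have := dist_midpoint_le_modconv_perturbed d0 e0 _ x1x x2x x12_neq.
rewrite x12 => /(_ ltac:(lra)); lra.
Unshelve. all: by end_near. Qed.

Lemma uniformly_well_posed_tube (M : R) :
  (forall x y, A x -> A y -> `|x - y| <= M) ->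
  (forall e, 0 < e <= M -> modnonconv A e < modconv_ball E d e) ->
  uniformly_well_posed A [set x | dist_to A x <= rho].
Proof.
move=> diam_le gap e e0.
have /compact_near_coveringP near_covering := @segment_compact R e M.
have uniform : \forall eta \near 0^'+, forall e', e' \in `[e, M] ->
    forall x x1 x2, dist_to A x <= rho ->
    near_projections A x eta x1 -> near_projections A x eta x2 -> `|x1 - x2| <> e'.
  apply: near_covering => e'; rewrite /= in_itv/= => /andP[ee' e'M].
  have e'0 := lt_le_trans e0 ee'.
  by apply: near_projections_dist_neq => //; apply: gap; rewrite e'0.
near (0 : R)^'+ => eta.
exists eta => // x x1 x2 x_rho x1P x2P; rewrite ltNge; apply/negP => ex12.
apply: (near uniform eta _ `|x1 - x2| _ x x1 x2) => //.
by rewrite in_itv/= ex12; apply: diam_le; [case: x1P|case: x2P].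
Unshelve. all: by end_near. Qed.

End WellPosedness.

Section ContinuousProjection.
Context {R : realType} {E : completeNormedModType R}.
Variables (A X : set E).
Hypotheses (closedA : closed A) (A0 : A !=set0) (wp : uniformly_well_posed A X).

Lemma exists_projection (x : E) : X x -> exists p, is_projection A x p.
Proof.
move=> Xx; have /choice[u u_] (n : nat) : exists y, near_projections A x n.+1%:R^-1 y.
  by have [y Ay /ltW yx] := @dist_to_adherent _ _ A x n.+1%:R^-1 A0 ltac:(by []); exists y.
have u_near (eta : R) : 0 < eta -> \forall n \near \oo, near_projections A x eta (u n).
  move=> eta0; near=> n; have [Aun unx] := u_ n; split => //.
  apply: le_trans unx _; rewrite lerD2l ltW//.
  by near: n; exact: near_infty_natSinv_lt (PosNum eta0).
have /cauchy_cvgP/cvg_ex[p up] : cauchy (u @ \oo).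
  apply: cauchy_exP => e /wp[eta eta0 close].
  have /filter_ex [N uN] := u_near _ eta0.
  exists (u N); rewrite /fmap/=; near=> n; rewrite -ball_normE /=; apply: (close x) => //.
  by near: n; exact: u_near.
have Ap : A p by apply: (closed_cvg A closedA _ p up); near=> n; case: (u_ n).
exists p; split => //; apply/eqP; rewrite eq_le dist_to_le// andbT.
apply/ler_addgt0Pr => eta eta0.
have dist_cvg : (fun n => `|u n - x|) @ \oo --> `|p - x|.
  by apply: cvg_norm; apply: cvgB => //; exact: cvg_cst.
apply: (closed_cvg _ (@closed_le _ (dist_to A x + eta)) _ _ dist_cvg).
by near=> n; have [] : near_projections A x eta (u n) by near: n; exact: u_near.
Unshelve. all: by end_near. Qed.

Lemma continuous_projection (p : E -> E) :
  (forall x, X x -> is_projection A x (p x)) -> {within X, continuous p}.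
Proof.
move=> pP; apply/subspace_continuousP => x Xx.
apply/cvgrPdist_lt => e /wp[eta eta0 close]; near=> y.
have Xy : X y by near: y; exact: withinT.
have xy : `|x - y| < eta / 2.
  by near: y; apply: cvg_within; apply: cvgr_dist_lt => //; rewrite divr_gt0.
apply: (close x) => //; apply: is_projection_near_projections (pP _ _) _ => //.
  by rewrite subrr normr0 mulr0 ltW.
by lra.
Unshelve. all: by end_near. Qed.

Lemma exists_continuous_projection :
  exists2 p : E -> E, {within X, continuous p} & forall x, X x -> is_projection A x (p x).
Proof.
have /choice[p pP] x : exists p, X x -> is_projection A x p.
  have [/exists_projection[p px]|nXx] := pselect (X x); first by exists p.
  by exists x => /nXx.
by exists p => //; exact: continuous_projection.
Qed.

End ContinuousProjection.

Lemma continuous_comp_within {S T U : topologicalType} (X : set T) (f : S -> T) (g : T -> U) :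
  continuous f -> (forall x, X (f x)) -> {within X, continuous g} -> continuous (g \o f).
Proof.
move=> cf fX /subspace_continuousP cg x.
apply: (cvg_comp f g _ (cg (f x) (fX x))).
by move=> V /cf; rewrite nbhs_simpl; apply: (filterS (F := nbhs x)) => y /(_ (fX y)).
Qed.

Section RadialRetraction.
Context {R : realType} {E : normedModType R}.
Variables (a : E) (r : R).
Hypothesis r0 : 0 < r.

Definition radial_retraction (x : E) : E := a + (r / Num.max r `|x - a|) *: (x - a).

Lemma radial_retraction_cball x : cball a r (radial_retraction x).
Proof.
rewrite /cball/= /radial_retraction addrAC subrr add0r normrZ.
have m0 : 0 < Num.max r `|x - a| by rewrite lt_max r0.
rewrite gtr0_norm ?divr_gt0// mulrAC ler_pdivrMr//.
by rewrite ler_pM2l// le_max lexx orbT.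
Qed.

Lemma radial_retraction_id x : cball a r x -> radial_retraction x = x.
Proof.
rewrite /cball/= /radial_retraction => /max_idPl ->.
by rewrite divff ?gt_eqF// scale1r addrC subrK.
Qed.

Lemma continuous_radial_retraction : continuous radial_retraction.
Proof.
move=> x; apply: cvgD; first exact: cvg_cst.
have cvg_xa : (y - a) @[y --> x] --> (x - a) by apply: cvgB => //; exact: cvg_cst.
apply: cvgZ => //; apply: cvgM; first exact: cvg_cst.
apply: cvgV; first by rewrite gt_eqF// lt_max r0.
apply: (@continuous_max _ _ (cst r) (fun y => `|y - a|) x); first exact: cvg_cst.
exact: cvg_norm.
Qed.

End RadialRetraction.

Theorem theorem3p4 (R : realType) (E : completeNormedModType R)
  (d : R) (A : set E) (a : E) (r : R) :
  uniformly_convex (E := E) ->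
  0 < d ->
  closed A -> A !=set0 ->
  weakly_convex A (2%:R * d) ->
  (forall eps : R, 0 < eps < 2%:R * d ->
     modnonconv A eps < d * modconv (E := E) (eps / d)) ->
  condition_i (fun t => d * modconv (E := E) (t / d)) (modnonconv A) (2%:R * d) ->
  0 < r -> 2%:R * r < d -> A `<=` cball a r ->
  (forall eps : R, 0 < eps < diam A ->
     modnonconv A eps < d * modconv (E := E) (eps / d)) ->
  exists phi : E -> E,
    [/\ continuous phi, (forall x, A (phi x)) & (forall x, A x -> phi x = x)].
Proof.
move=> _ d0 closedA A0 _ gap _ r0 rd Ar _.
have diamA x y : A x -> A y -> `|x - y| <= 2%:R * r.
  by move=> /Ar xa /Ar ya; exact: cball_dist_le xa ya.
have cball_tube : cball a r `<=` [set x | dist_to A x <= 2%:R * r].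
  move=> x xa; have [y Ay] := A0; apply: (le_trans (dist_to_le x Ay)).
  exact: cball_dist_le (Ar y Ay) xa.
have wp : uniformly_well_posed A (cball a r).
  apply: uniformly_well_posedW cball_tube _.
  apply: (uniformly_well_posed_tube d0 rd diamA) => e e_itv.
  by apply: gap; lra.
have [p p_cont pP] := exists_continuous_projection closedA A0 wp.
have retr_cball := radial_retraction_cball a r0.
exists (p \o radial_retraction a r); split => [|x|x Ax] /=.
- exact: continuous_comp_within (@continuous_radial_retraction _ _ a r r0) retr_cball p_cont.
- by have [] := pP _ (retr_cball x).
- rewrite radial_retraction_id//; last exact: Ar.
  exact: is_projection_id Ax (pP _ (Ar x Ax)).
Qed.
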